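(* For every integer $d\ge 0$, $$E_d = \sum_{\delta \in \mathrm{PCom}_{\mathrm{sqf}}(d)} (-1)^{\ell(\delta)}\frac{P_\delta}{Z_\delta}.$$
   Context: A composition of $n\ge 0$ is a finite tuple $\alpha=(\alpha_1,\dots,\alpha_l)$ of positive integers with sum $n$; $\ell(\alpha)=l$; the empty composition is the only composition of $0$. A polycomposition of $n$ is a sequence $\delta=(\alpha^{(1)},\alpha^{(2)},\dots)$ of (possibly empty) compositions with $\sum_{i\ge1} i|\alpha^{(i)}|=n$; write formally (not exponentiation) $\delta=(\alpha^{(1)})^1(\alpha^{(2)})^2\cdots$, omitting empty compositions. Its length is $\ell(\delta)=\sum_i\ell(\alpha^{(i)})$. Each part $d$ of $\alpha^{(r)}$ gives a block $d^r$ of $\delta$. $\mathrm{PCom}_{\mathrm{sqf}}(d)$ is the set of square-free polycompositions of $d$: those of the form $(\alpha)^1$ with $\alpha$ a composition of $d$. For a composition $\alpha=(\alpha_1,\dots,\alpha_l)$ put $Z_\alpha=\alpha_1(\alpha_1+\alpha_2)(\alpha_1+\alpha_2+\alpha_3)\cdots(\alpha_1+\cdots+\alpha_l)$ (equal to $1$ for the empty composition), and for $\delta=(\alpha)^1$ put $Z_\delta=Z_\alpha$. Let $x_{i,j}$ ($i,j\ge 1$) be indeterminates with $\deg x_{i,j}=i$; all series have rational coefficients. A monomial is square-free if every exponent is at most $1$. $E_d$ is the sum over square-free monomials $f$ of degree $d$ of $(-1)^{m(f)}f$, where $m(f)$ is the number of indeterminates in $f$ (so $E_0=1$). For $d\ge1$,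 $P_d=\sum_{k\mid d}\sum_{j\ge1} k\,x_{k,j}^{d/k}$, with $k$ ranging over positive divisors of $d$. For a block $d^r$, $P_{d^r}$ is obtained from $P_d$ by replacing each $x_{i,j}$ by $x_{i,j}^r$, and $P_\delta=\prod P_{d^r}$ over all blocks $d^r$ of $\delta$ (counted with repetition; empty product $=1$). *)

(* Defs.v *)
From HB Require Import structures.
From mathcomp Require Import all_boot all_order all_algebra finmap.
From mathcomp Require Import boolp classical_sets functions cardinality fsbigop.
From mathcomp.multinomials Require Import monalg.

Set Implicit Arguments.
Unset Strict Implicit.
Unset Printing Implicit Defensive.

Import GRing.Theory.

Local Open Scope classical_set_scope.
Local Open Scope ring_scope.

(* The pair (i, j) stands for the indeterminate x_{i,j}, with i, j >= 1. *)
Notation indet := {p : nat * nat | (0 < p.1)%N && (0 < p.2)%N}.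
Notation monomial := {cmonom indet}.

Definition mono_deg (m : monomial) : nat :=
  (\sum_(x <- finsupp m) (val x).1 * m x)%N.

Definition square_free (m : monomial) : Prop := forall x, (m x <= 1)%N.

(* A formal power series is the family of its coefficients.  The product on   *)
(* this type is the Cauchy product, not the pointwise product of functions.   *)
Definition series : Type := monomial -> rat^o.

HB.instance Definition _ := GRing.Lmodule.copy series (monomial -> rat^o).

Definition series_mono (m : monomial) : series := fun m' => (m' == m)%:R.

(* The index set of this sum is finite (finite_factorizations below).         *)
Definition series_mul (f g : series) : series := fun m =>
  \sum_(p \in [set p : monomial * monomial | mmul p.1 p.2 = m])
    (f p.1 * g p.2 : rat).

Lemma finite_factorizations (m : monomial) :
  finite_set [set p : monomial * monomial | mmul p.1 p.2 = m].
Proof.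
pose T := finsupp m; pose n := (mdeg m).+1.
pose G (h : {ffun T -> 'I_n}) : monomial :=
  mkcmonom [fsfun i : T => nat_of_ord (h i) | 0%N].
have le_deg x : (m x < n)%N.
  rewrite ltnS; case: mdomP => // xm.
  by rewrite mdegE (big_fsetD1 x) //= leq_addr.
have divG (a b : monomial) : mmul a b = m -> exists h, a = G h.
  move=> abm; have alt (i : T) : (a (val i) < n)%N.
    by apply: leq_ltn_trans (le_deg (val i)); rewrite -abm cmM leq_addr.
  exists [ffun i => Ordinal (alt i)].
  apply/eqP/cmP => x; rewrite cmE fsfun_ffun.
  case: insubP => [i xT <-|xT] /=; first by rewrite ffunE.
  have : m x = 0%N by apply/eqP; rewrite cmE_eq0.
  by rewrite -abm cmM => /eqP; rewrite addn_eq0 => /andP[/eqP].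
apply: (@sub_finite_set _ _ ((fun q => (G q.1, G q.2)) @` setT)).
  move=> [a b] /= abm.
  have [h ah] := divG a b abm.
  have [k bk] : exists k, b = G k by apply: (divG b a); rewrite mulmC.
  by exists (h, k) => //=; rewrite -ah -bk.
exact/finite_image/finite_finset.
Qed.

Section SeriesRing.
Implicit Types (f g h : series) (m : monomial).

(* A finite list closed under the factorizations of m computes coefficients   *)
(* at m and at every divisor of m.                                            *)
Let divs m : seq monomial :=
  undup [seq p.1 |
    p <- fset_set [set p : monomial * monomial | mmul p.1 p.2 = m]].

Let mem_divs m a b : mmul a b = m -> a \in divs m.
Proof.
move=> abm; rewrite mem_undup; apply/mapP; exists (a, b) => //=.
by rewrite in_fset_set; [rewrite inE | exact: finite_factorizations].
Qed.

Let mul_divs m a b f g : mmul a b = m ->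
  series_mul f g a =
  \sum_(c <- divs m) \sum_(d <- divs m) f c * g d * (mmul c d == a)%:R :> rat.
Proof.
move=> abm; rewrite /series_mul.
have U : uniq (divs m) by exact: undup_uniq.
rewrite (fsbigE [seq p <- [seq (c, d) | c <- divs m, d <- divs m]
                 | mmul p.1 p.2 == a]) /=.
- rewrite big_filter_cond big_mkcond big_allpairs_dep /=.
  apply: eq_bigr => c _; apply: eq_bigr => d _.
  by case: eqP => cda; rewrite ?mulr0 //= mulr1 mem_set.
- by rewrite filter_uniq // allpairs_uniq // => -[? ?] [? ?].
- by move=> p /=; rewrite mem_filter => /andP[/eqP].
- move=> [c d] /= cda; rewrite mem_filter cda eqxx /= allpairs_f //.
    by apply: (@mem_divs _ _ (mmul d b)); rewrite mulmA cda.
  by apply: (@mem_divs _ _ (mmul c b)); rewrite mulmA [mmul d c]mulmC cda.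
Qed.

Fact series_mulC : commutative series_mul.
Proof.
move=> f g; apply/funext => m.
have m1 : mmul m mone = m by rewrite mulm1.
rewrite !(mul_divs _ _ m1) exchange_big; apply: eq_bigr => c _.
by apply: eq_bigr => d _; rewrite mulmC [f _ * _]mulrC.
Qed.

Let mul_mul f g h m : series_mul f (series_mul g h) m =
  \sum_(a <- divs m) \sum_(b <- divs m) \sum_(c <- divs m)
    f a * (g b * h c) * (mmul a (mmul b c) == m)%:R :> rat.
Proof.
rewrite (mul_divs _ _ (mulm1 m)); apply: eq_bigr => a _.
transitivity (\sum_(e <- divs m) \sum_(b <- divs m) \sum_(c <- divs m)
    f a * (g b * h c) * (mmul b c == e)%:R * (mmul a e == m)%:R : rat).
  apply: eq_big_seq => e; rewrite mem_undup => /mapP[[e1 e2] /=].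
  rewrite in_fset_set; last exact: finite_factorizations.
  rewrite inE /= => em ->; rewrite (mul_divs _ _ em) mulr_sumr mulr_suml.
  apply: eq_bigr => b _; rewrite mulr_sumr mulr_suml.
  by apply: eq_bigr => c _; rewrite !mulrA.
rewrite exchange_big; apply: eq_bigr => b _.
rewrite exchange_big; apply: eq_bigr => c _.
under eq_bigr do rewrite -mulrA; rewrite -mulr_sumr; congr (_ * _).
case: eqP => [abcm|abcm].
  have bcd : mmul b c \in divs m by apply: (mem_divs (b := a)); rewrite mulmC.
  rewrite (bigD1_seq (mmul b c)) ?undup_uniq //= abcm !eqxx mulr1.
  by rewrite big1 ?addr0 // => e; rewrite eq_sym => /negPf ->; rewrite mul0r.
rewrite big1 // => e _; case: eqP => [<-|_]; last by rewrite mul0r.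
by rewrite (introF eqP abcm) mulr0.
Qed.

Fact series_mulA : associative series_mul.
Proof.
move=> f g h; rewrite [RHS]series_mulC; apply/funext => m; rewrite !mul_mul.
under eq_bigr do rewrite exchange_big; rewrite exchange_big /=.
apply: eq_bigr => c _; apply: eq_bigr => a _; apply: eq_bigr => b _.
by congr (_ * (_ == m)%:R); [rewrite mulrA mulrC | rewrite mulmA mulmC].
Qed.

Fact series_mul1 : left_id (series_mono mone) series_mul.
Proof.
move=> f; apply/funext => m; rewrite /series_mul.
rewrite (fsbigE [:: (mone : monomial, m)]) //=.
- rewrite big_mkcond big_seq1 mem_set /= ?mul1m //.
  by rewrite /series_mono eqxx mul1r.
- by move=> p /=; rewrite inE => /eqP -> /=; rewrite mul1m.
- move=> [a b] /= abm; rewrite inE /series_mono xpair_eqE.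
  case: eqP => [a1|_ _]; last by rewrite mul0r.
  by move: abm; rewrite a1 mul1m => ->; rewrite eqxx.
Qed.

Fact series_mulDl : left_distributive series_mul +%R.
Proof.
move=> f g h; apply/funext => m; rewrite /series_mul.
apply: etrans (fsbig_split _ _ _ (finite_factorizations m)).
by apply: eq_fsbigr => p _; exact: mulrDl.
Qed.

Fact series_oner_neq0 : series_mono mone != 0.
Proof.
apply/eqP => /(congr1 (fun f : series => f mone)).
by rewrite /series_mono eqxx => /eqP; rewrite oner_eq0.
Qed.
End SeriesRing.

HB.instance Definition _ := GRing.Zmodule_isComNzRing.Build series
  series_mulA series_mulC series_mul1 series_mulDl series_oner_neq0.

(* The sum of a family of series in which every monomial has a nonzero        *)
(* coefficient in only finitely many members.                                 *)
Definition series_sum (I : choiceType) (A : set I) (F : I -> series) : series :=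
  fun m => \sum_(i \in A) (F i m : rat).

Definition E (d : nat) : series :=
  series_sum [set f | square_free f /\ mono_deg f = d]
    (fun f => (-1) ^+ #|` finsupp f| *: series_mono f).

(* Meant for d >= 1; divisors 0 is empty, so P 0 = 0.                        *)
Definition P (d : nat) : series :=
  \sum_(k <- divisors d)
    series_sum [set x : indet | (val x).1 = k]
      (fun x => k%:R *: series_mono (expcmn (ucm x) (d %/ k))).

(* The series obtained from f by replacing every indeterminate x by x ^ r.    *)
Definition series_subst (r : nat) (f : series) : series :=
  series_sum setT (fun m => f m *: series_mono (expcmn m r)).

Definition P_block (d r : nat) : series := series_subst r (P d).

Definition composition (n : nat) (a : seq nat) : Prop :=
  all (leq 1) a /\ sumn a = n.

(* The value of delta at i is the i-th composition; the indices start at 1,   *)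
(* so the value at 0 is required to be empty.                                 *)
Notation comp_seq := {fsfun nat -> seq nat with [::]}.

Definition polycomposition (n : nat) (delta : comp_seq) : Prop :=
  [/\ delta 0%N = [::],
      forall i, all (leq 1) (delta i)
    & \sum_(i <- finsupp delta) i * sumn (delta i) = n]%N.

(* The polycomposition usually written (a)^1.                                 *)
Definition pcom_of_comp (a : seq nat) : comp_seq :=
  [fsfun [fsfun] with 1%N |-> a].

Definition PCom_sqf (d : nat) : set comp_seq :=
  [set delta : comp_seq | polycomposition d delta /\
     exists2 a, composition d a & delta = pcom_of_comp a].

Lemma finite_PCom_sqf (d : nat) : finite_set (PCom_sqf d).
Proof.
pose G (q : d.-bseq 'I_d.+1) : comp_seq := pcom_of_comp (map val q).
apply: (@sub_finite_set _ _ (G @` setT)); last first.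
  exact/finite_image/finite_finset.
move=> _ [_ [a [a_gt0 a_sum] ->]].
have size_sum (s : seq nat) : all (leq 1) s -> (size s <= sumn s)%N.
  by elim: s => //= x s IHs /andP[x_gt0 /IHs]; rewrite -add1n; apply: leq_add.
have le_sum (s : seq nat) x : x \in s -> (x <= sumn s)%N.
  elim: s => //= y s IHs; rewrite inE => /orP[/eqP->|/IHs/leq_trans->//].
    exact: leq_addr.
  exact: leq_addl.
have size_a : (size (map (@inord d) a) <= d)%N.
  by rewrite size_map -a_sum size_sum.
exists (Bseq size_a) => //; congr pcom_of_comp; rewrite -map_comp /=.
rewrite -[RHS]map_id; apply/eq_in_map => x xa /=.
by rewrite inordK // ltnS -a_sum le_sum.
Qed.

Definition pcom_length (delta : comp_seq) : nat :=
  (\sum_(i <- finsupp delta) size (delta i))%N.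

Definition P_pcom (delta : comp_seq) : series :=
  \prod_(r <- finsupp delta) \prod_(d <- delta r) P_block d r.

Definition Z (a : seq nat) : nat :=
  (\prod_(i < size a) sumn (take i.+1 a))%N.

(* Only meaningful on square-free polycompositions, where delta = (a)^1.      *)
Definition Z_pcom (delta : comp_seq) : nat := Z (delta 1%N).

(* Main.v *)
(* At a monomial m, the identity d E_d = - sum_(1 <= k <= d) P_k E_(d-k) can be
   checked one indeterminate at a time: P_k only involves powers x^n of single
   indeterminates, and the coefficient of m in E_d (when deg m = d) is the
   product over x of c(m x), with c(0) = 1, c(1) = -1 and c = 0 elsewhere, so
   the identity reduces to sum_(j < n) c(j) = - n c(n).  The sum over
   compositions satisfies the same recursion, since removing the last part of a
   composition of d removes the factor d from Z. *)

Require Import Defs.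
From mathcomp Require Import all_boot all_order all_algebra finmap.
From mathcomp Require Import boolp classical_sets functions cardinality fsbigop.
From mathcomp.multinomials Require Import monalg.

Import GRing.Theory Num.Theory.
Local Open Scope ring_scope.

(** * Coefficients of series, powers of one indeterminate, degrees *)

Lemma series_sumE (I : Type) (r : seq I) (Q : pred I) (F : I -> series) m :
  (\sum_(i <- r | Q i) F i) m = \sum_(i <- r | Q i) (F i m : rat).
Proof. by elim/big_rec2: _ => // i y f _ <-. Qed.

Lemma series_scaleE (c : rat) (f : series) m : (c *: f) m = c * f m.
Proof. by []. Qed.

Lemma series_mulZr (c : rat) (f g : series) : f * (c *: g) = c *: (f * g).
Proof.
apply/funext => m; rewrite series_scaleE /GRing.mul /= /series_mul.
rewrite [RHS]mulr_fsumr.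
by apply: eq_fsbigr => p _; rewrite mulrCA.
Qed.

(** Lets a sparse first factor, later [P k], cut the Cauchy product down to the factorizations that
    start in its support. *)
Lemma series_mulE (r : seq (monomial * monomial)) (f g : series) m :
    uniq r -> {in r, forall p, mmul p.1 p.2 = m} ->
    (forall a b, mmul a b = m -> (a, b) \notin r -> f a = 0) ->
  (f * g) m = \sum_(p <- r) (f p.1 * g p.2 : rat).
Proof.
move=> Ur rm f0; rewrite /GRing.mul /= /series_mul (fsbigE r) //.
- rewrite big_seq_cond [RHS]big_seq; apply: eq_bigl => p.
  by apply: andb_idr => /rm ?; rewrite mem_set.
- by move=> [a b] /= /f0 H /H ->; rewrite mul0r.
Qed.

Lemma expcmnE (m : monomial) n x : expcmn m n x = (n * m x)%N.
Proof.
rewrite /expcmn.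
case: n => [|n]; first by rewrite /= onecmE mul0n.
rewrite iteropS; elim: n => [|n IHn]; first by rewrite mul1n.
by rewrite iterS mulcmE IHn -mulSn.
Qed.

Lemma expcmn_ucmE (x y : indet) n : expcmn (ucm x) n y = (n * (x == y))%N.
Proof. by rewrite expcmnE ucmE. Qed.

(** Comparing exponents at [x] suffices; positivity of [n] excludes the unit monomial, which is the
    zeroth power of every indeterminate. *)
Lemma expcmn_ucm_inj (x y : indet) n k :
  (0 < n)%N -> expcmn (ucm x) n = expcmn (ucm y) k -> x = y /\ n = k.
Proof.
move=> n0 /(congr1 (fun m : monomial => m x)); rewrite !expcmn_ucmE eqxx muln1.
by case: eqP => [->|_]; rewrite ?muln1 ?muln0 // => nE; rewrite nE in n0.
Qed.

Lemma mono_degE (S : {fset indet}) (m : monomial) : (finsupp m `<=` S)%fset ->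
  mono_deg m = (\sum_(x <- S) (val x).1 * m x)%N.
Proof.
move=> mS; rewrite /mono_deg; apply: big_fset_incl => // x _.
by rewrite -cmE_eq0 => /eqP ->; rewrite muln0.
Qed.

Lemma mono_degM (a b : monomial) :
  mono_deg (mmul a b) = (mono_deg a + mono_deg b)%N.
Proof.
rewrite {1}/mono_deg mdomD (mono_degE _ a (fsubsetUl _ (finsupp b))).
rewrite (mono_degE _ b (fsubsetUr (finsupp a) _)) -big_split.
by apply: eq_bigr => x _; rewrite cmM mulnDr.
Qed.

Lemma mono_deg_expcmn_ucm (x : indet) n :
  mono_deg (expcmn (ucm x) n) = (n * (val x).1)%N.
Proof.
rewrite (@mono_degE [fset x]%fset).
  by rewrite big_seq_fset1 expcmn_ucmE eqxx muln1 mulnC.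
apply/fsubsetP => y; rewrite in_fset1 -cmE_neq0 expcmn_ucmE.
by case: (x =P y) => [->|]; rewrite ?muln0 ?eqxx.
Qed.

(** * Coefficients of [P] and [E] *)

Lemma P_expcmn_ucm (d n : nat) (x : indet) : (0 < d)%N -> (0 < n)%N ->
  P d (expcmn (ucm x) n) = if (d == n * (val x).1)%N then (val x).1%:R else 0.
Proof.
move=> d0 n0; rewrite /P series_sumE.
have x0 : (0 < (val x).1)%N by case/andP: (valP x).
have E k : series_sum [set y : indet | (val y).1 = k]
        (fun y => k%:R *: series_mono (expcmn (ucm y) (d %/ k)))
        (expcmn (ucm x) n)
      = (if (k == (val x).1) && (n == d %/ k)%N then k%:R else 0 : rat).
  (* This list is [[:: x]] or empty: only [y = x] can contribute, and it is indexed only when [k] is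
     the degree of [x]. *)
  rewrite /series_sum (fsbigE (nseq (k == (val x).1) x)).
  - case: eqP => [->|_] /=; last by rewrite big_nil.
    rewrite big_mkcond big_seq1 mem_set // series_scaleE /series_mono.
    case: eqP => [/(expcmn_ucm_inj _ _ _ _ n0)[_ <-]|ne].
      by rewrite eqxx mulr1.
    by case: eqP => [nE|]; [case: ne; rewrite nE | rewrite mulr0].
  - by case: eqP.
  - by move=> y /=; case: eqP => //= ->; rewrite inE => /eqP ->.
  - move=> y /= yk; rewrite series_scaleE /series_mono.
    case: (expcmn _ _ =P _) => [/(expcmn_ucm_inj _ _ _ _ n0)[-> _]|_ _].
      by rewrite -yk eqxx inE eqxx.
    by rewrite mulr0.
under eq_bigr do rewrite E.
case: (altP eqP) => [dE|dN].
  rewrite (bigD1_seq (val x).1) ?divisors_uniq ?eqxx //=; last first.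
    by rewrite dE -dvdn_divisors ?muln_gt0 ?n0 // dvdn_mull.
  rewrite dE mulnK // eqxx big1 ?addr0 // => k /negPf -> //.
rewrite big_seq big1 // => k.
rewrite -dvdn_divisors // => kd; case: eqP => //= kE; case: eqP => // nE.
by move: dN; rewrite nE -kE divnK // eqxx.
Qed.

Lemma P_neq0 (d : nat) (m : monomial) : (0 < d)%N -> P d m != 0 ->
  exists x n, (0 < n)%N /\ m = expcmn (ucm x) n.
Proof.
move=> d0; rewrite /P series_sumE; apply: contraNP => H; apply/eqP.
rewrite big_seq big1 // => k; rewrite -dvdn_divisors // => kd.
rewrite /series_sum fsbig1 // => x /= xk; rewrite series_scaleE /series_mono.
case: eqP => [mE|]; last by rewrite mulr0.
case: H; exists x, (d %/ k)%N; split=> [|//].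
by rewrite divn_gt0 ?(dvdn_gt0 d0 kd) //; exact: dvdn_leq.
Qed.

(* The coefficient of y ^ n in 1 - y. *)
Definition sqf_sign (n : nat) : rat :=
  match n with 0%N => 1 | 1%N => -1 | _ => 0 end.

(** Both sides are the coefficient of y ^ n in y: the left one comes from (y / (1 - y)) * (1 - y),
    the right one from - y * (1 - y)'. *)
Lemma sum_sqf_sign n :
  \sum_(0 <= j < n) sqf_sign j = - (n%:R * sqf_sign n).
Proof.
case: n => [|[|n]]; first by rewrite big_nil mul0r oppr0.
  by rewrite big_nat1 mul1r opprK.
by rewrite !big_nat_recl //= big1 // addr0 subrr mulr0 oppr0.
Qed.

(** Since [sqf_sign 0 = 1], the product may run over any set containing the support. This allows [m]
    and its divisors to be compared over the same set. *)
Lemma E_coef (S : {fset indet}) (d : nat) (m : monomial) :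
    (finsupp m `<=` S)%fset ->
  E d m = if (mono_deg m == d)%N then \prod_(x <- S) sqf_sign (m x) else 0.
Proof.
move=> mS; rewrite /E /series_sum.
set A := (X in \sum_(i \in X) _).
rewrite (fsbigE [seq f <- [:: m] | f \in A]); first last.
- move=> f fA; rewrite mem_filter inE mem_set //= series_scaleE /series_mono.
  by rewrite eq_sym => /negPf ->; rewrite mulr0.
- move=> f fr; have : f \in [seq f <- [:: m] | f \in A] := fr.
  by rewrite mem_filter => /andP[/set_mem].
- by rewrite filter_uniq.
rewrite big_filter_cond big_mkcond big_seq1 andbb series_scaleE /series_mono.
rewrite eqxx mulr1.
case: (altP (_ =P d)) => [md|mNd]; last first.
  by rewrite memNset // => -[_] /eqP; apply/negP.
have [sqf|] := pselect (square_free m); last first.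
  move=> nsqf; rewrite memNset; last by case.
  have [x /negP] : exists x, ~ (m x <= 1)%N by apply/existsNP.
  rewrite -ltnNge => mx.
  have xS : x \in S.
    by apply: (fsubsetP mS); rewrite -cmE_neq0 -lt0n (ltn_trans _ mx).
  (* An exponent of at least 2 gives a zero factor. *)
  by rewrite (bigD1_seq x) //=; case: (m x) mx => [|[|k]] //= _; rewrite mul0r.
rewrite mem_set //; transitivity (\prod_(x <- finsupp m) sqf_sign (m x)).
  rewrite (eq_big_seq (fun=> -1)); last first.
    by move=> x; rewrite -cmE_neq0; case: (m x) (sqf x) => [|[|]].
  by rewrite big_const_seq count_predT iter_mulr_1.
by apply: big_fset_incl => // x _; rewrite -cmE_eq0 => /eqP ->.
Qed.

(** Every indeterminate has positive degree, so only the unit monomial has degree 0. *)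
Lemma E0 : E 0 = 1.
Proof.
apply/funext => m; rewrite (E_coef (finsupp m)) //.
rewrite [RHS]/(series_mono mone m) /series_mono.
case: (altP (m =P _)) => [->|m1].
  by rewrite /mono_deg mdom1 !big_seq_fset0 eqxx.
case: eqP => // /eqP; rewrite /mono_deg sum_nat_seq_eq0 => /allP m0.
case/negP: m1; apply/cmP => x; rewrite cm1; apply/eqP; rewrite cmE_eq0.
apply/negP => xm; have := m0 x xm; rewrite /= muln_eq0 => /orP[x0|].
  by case/andP: (valP x); rewrite lt0n x0.
by rewrite cmE_eq0 xm.
Qed.

(** * The Newton-type recursion for [E] *)

Lemma newton_E (d : nat) :
  d%:R *: E d = - \sum_(1 <= k < d.+1) P k * E (d - k).
Proof.
apply/funext => m; rewrite {1}/GRing.opp /= series_scaleE series_sumE.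
(* The factorizations of [m] whose first factor is a positive power of one indeterminate; [P k]
   vanishes on all other first factors. *)
pose r : seq (monomial * monomial) :=
  [seq (expcmn (ucm x) n, divcm m (expcmn (ucm x) n))
    | x <- finsupp m, n <- iota 1 (m x)].
have divK (x : indet) n : (n <= m x)%N ->
    mmul (expcmn (ucm x) n) (divcm m (expcmn (ucm x) n)) = m.
  move=> nm; apply/eqP/cmP => y; rewrite cmM divcmE subnKC //.
  by rewrite expcmn_ucmE; case: eqP => [<-|]; rewrite ?muln1 ?muln0.
have mulE k : (0 < k)%N -> (P k * E (d - k)) m =
    \sum_(x <- finsupp m) \sum_(n <- iota 1 (m x))
      P k (expcmn (ucm x) n) * E (d - k) (divcm m (expcmn (ucm x) n)).
  move=> k0; rewrite (series_mulE r) /r ?big_allpairs_dep //.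
  - apply: allpairs_uniq_dep => [|x _|].
    + exact: fset_uniq.
    + exact: iota_uniq.
    move=> _ _ /allpairsPdep[x [n [xm nm ->]]]
      /allpairsPdep[y [l [ym lm ->]]] /= [].
    have n0 : (0 < n)%N by move: nm; rewrite mem_iota; case/andP.
    by move=> /(expcmn_ucm_inj _ _ _ _ n0)[-> ->].
  - move=> _ /allpairsPdep[x [n [xm nm ->]]] /=; apply: divK.
    by move: nm; rewrite mem_iota add1n ltnS => /andP[].
  move=> a b abm; apply: contraNeq => /(P_neq0 _ _ k0) [x [n [n0 aE]]].
  have mx : m x = (n + b x)%N by rewrite -abm cmM aE expcmn_ucmE eqxx muln1.
  apply/allpairsPdep; exists x, n; split.
  - by rewrite -cmE_neq0 mx -lt0n ltn_addr.
  - by rewrite mem_iota n0 mx add1n ltnS leq_addr.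
  - rewrite -aE; congr pair; apply/esym/eqP/cmP => y.
    by rewrite divcmE -abm cmM addKn.
rewrite big_nat; under eq_bigr => k /andP[k0 _] do rewrite mulE //.
rewrite -big_nat.
rewrite exchange_big /=.
(* The contribution to the coefficient of [E] of all indeterminates of [m] other than [x]. *)
pose p x : rat := \prod_(y <- finsupp m | y != x) sqf_sign (m y).
have sumk x n : x \in finsupp m -> n \in iota 1 (m x) ->
    \sum_(1 <= k < d.+1)
      P k (expcmn (ucm x) n) * E (d - k) (divcm m (expcmn (ucm x) n))
    = (if (mono_deg m == d)%N
       then (val x).1%:R * p x * sqf_sign (m x - n)%N else 0 : rat).
  move=> xm; rewrite mem_iota add1n ltnS => /andP[n0 nm].
  have x0 : (0 < (val x).1)%N by case/andP: (valP x).
  have dm := mono_degM (expcmn (ucm x) n) (divcm m (expcmn (ucm x) n)).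
  rewrite divK // mono_deg_expcmn_ucm in dm.
  rewrite big_nat; under eq_bigr => k /andP[k0 _] do rewrite P_expcmn_ucm //.
  rewrite -big_nat.
  have sub : (finsupp (divcm m (expcmn (ucm x) n)) `<=` finsupp m)%fset.
    apply/fsubsetP => y; rewrite -!cmE_neq0 divcmE; apply: contraNneq => ->.
    by rewrite sub0n.
  have prodE :
      \prod_(y <- finsupp m) sqf_sign (divcm m (expcmn (ucm x) n) y)
      = p x * sqf_sign (m x - n)%N.
    rewrite (bigD1_seq x) //= mulrC divcmE expcmn_ucmE eqxx muln1.
    congr (_ * _).
    apply: eq_bigr => y; rewrite divcmE expcmn_ucmE eq_sym => /negPf ->.
    by rewrite muln0 subn0.
  (* The only [k] that can contribute is the degree of x ^ n. If it exceeds [d], it is out of range,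
     but then [m], a multiple of x ^ n, does not have degree [d] either. *)
  case: (leqP (n * (val x).1) d) => [le_d|gt_d].
    rewrite (bigD1_seq (n * (val x).1)%N) ?iota_uniq //=; last first.
      by rewrite mem_index_iota muln_gt0 n0 x0 ltnS.
    rewrite eqxx big1 ?addr0; last by move=> k /negPf ->; rewrite mul0r.
    rewrite (E_coef (finsupp m)) // prodE dm.
    rewrite -(eqn_add2l (n * (val x).1)) subnKC //.
    by case: eqP => _; rewrite ?mulr0 // mulrA.
  rewrite big_nat big1; last first.
    move=> k /andP[_ kd]; case: eqP => [kE|]; last by rewrite mul0r.
    by move: gt_d; rewrite -kE ltnNge -ltnS kd.
  by case: eqP => // mE; move: gt_d; rewrite -mE dm ltnNge leq_addr.
rewrite (E_coef (finsupp m)) //.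
rewrite [X in - X](_ : _ = if (mono_deg m == d)%N
    then - (d%:R * \prod_(x <- finsupp m) sqf_sign (m x)) else 0).
  by case: eqP => _; rewrite ?opprK // mulr0 oppr0.
transitivity (\sum_(x <- finsupp m) \sum_(n <- iota 1 (m x))
    if (mono_deg m == d)%N
    then (val x).1%:R * p x * sqf_sign (m x - n)%N else 0).
  apply: eq_big_seq => x xm; rewrite exchange_big.
  by apply: eq_big_seq => n; exact: sumk.
case: eqP => [<-|_]; last by rewrite big1 // => x _; rewrite big1.
(* Writing [d] as the sum of the degrees contributed by each [x] lets the two sides be matched one
   indeterminate at a time. *)
rewrite /mono_deg natr_sum mulr_suml -sumrN; apply: eq_big_seq => x xm.
rewrite -mulr_sumr.
have -> : \sum_(n <- iota 1 (m x)) sqf_sign (m x - n)%N =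
          \sum_(0 <= j < m x) sqf_sign j.
  (* Substitute j = m x - n, which runs over 0, ..., m x - 1. *)
  rewrite big_nat_rev /= /index_iota subn0 (iotaDl 1 0) big_map.
  by apply: eq_bigr => j _; rewrite add0n add1n.
rewrite sum_sqf_sign (bigD1_seq x) //= natrM mulrN -/(p x).
by rewrite -!mulrA; congr (- (_ * _)); rewrite mulrC -mulrA.
Qed.

(** * From square-free polycompositions to compositions *)

Lemma series_subst1 (f : series) : series_subst 1 f = f.
Proof.
apply/funext => m; rewrite /series_subst /series_sum.
have expcmn1 (a : monomial) : expcmn a 1 = a by [].
rewrite (fsbigTE [fset m]%fset) => [|a]; last first.
  rewrite in_fset1 series_scaleE /series_mono expcmn1 eq_sym => /negPf ->.
  by rewrite mulr0.
by rewrite big_seq_fset1 series_scaleE /series_mono expcmn1 eqxx mulr1.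
Qed.

Lemma pcom_of_compE a : pcom_of_comp a 1%N = a.
Proof. by rewrite /pcom_of_comp fsfun_withE eqxx. Qed.

(** The support is {1}, except that it is empty when [a] is empty; the hypothesis on [F] makes both
    cases agree. *)
Lemma big_pcom_of_comp (R : Type) (idx : R) (op : Monoid.com_law idx)
    (F : nat -> seq nat -> R) a : (forall i, F i [::] = idx) ->
  \big[op/idx]_(i <- finsupp (pcom_of_comp a)) F i (pcom_of_comp a i) = F 1%N a.
Proof.
move=> F0; rewrite finsupp_with finsupp0.
case: eqP => [->|_]; first by rewrite fset0D big_seq_fset0 F0.
by rewrite fsetU0 big_seq_fset1 pcom_of_compE.
Qed.

Lemma P_pcom_of_comp a : P_pcom (pcom_of_comp a) = \prod_(k <- a) P k.
Proof.
rewrite /P_pcom.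
rewrite (big_pcom_of_comp _ _ _ (fun r b => \prod_(d <- b) P_block d r)).
  by apply: eq_bigr => k _; rewrite /P_block series_subst1.
by move=> i; rewrite big_nil.
Qed.

Lemma pcom_length_of_comp a : pcom_length (pcom_of_comp a) = size a.
Proof. by rewrite /pcom_length (big_pcom_of_comp _ _ _ (fun=> size)). Qed.

(** * Recursion on the last part of a composition *)

Lemma Z_rcons a k : Z (rcons a k) = (Z a * (sumn a + k))%N.
Proof.
rewrite /Z size_rcons big_ord_recr /= take_oversize ?size_rcons // sumn_rcons.
congr (_ * _)%N; apply: eq_bigr => i _.
by rewrite -cats1 takel_cat.
Qed.

(* n is fuel: the list is complete as soon as d <= n. *)
Fixpoint compositions (n d : nat) : seq (seq nat) :=
  if d is 0 then [:: [::]] else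
  if n is n'.+1 then
    [seq rcons a k | k <- index_iota 1 d.+1, a <- compositions n' (d - k)]
  else [::].

Lemma mem_compositions n d a :
  (d <= n)%N -> composition d a <-> a \in compositions n d.
Proof.
elim: n d a => [|n IHn] [|d] a //; rewrite /composition.
1,2: by move=> _; rewrite inE; split=> [[]|/eqP ->//]; case: a => // -[].
rewrite ltnS => dn; split.
  case/lastP: a => [[]//|a k].
  rewrite all_rcons sumn_rcons => -[/andP[k0 a0] s].
  apply/allpairsPdep; exists k, a; split=> //.
    by rewrite mem_index_iota k0 -s ltnS leq_addl.
  apply/IHn; last by rewrite -s addnK.
  rewrite -(leq_add2r k) subnK -?s ?leq_addl // s addnC.
  by case: k k0 {s} => // k _; rewrite addSn ltnS (leq_trans dn) ?leq_addl.
case/allpairsPdep => k [b [+ + ->]].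
rewrite mem_index_iota ltnS => /andP[k0 kd].
(* The last part is at least 1, so one unit of fuel per part is enough. *)
have dkn : (d.+1 - k <= n)%N.
  by case: k k0 kd => // k _ _; rewrite subSS (leq_trans (leq_subr _ _)).
by move/(IHn _ _ dkn) => [b0 bs]; rewrite all_rcons sumn_rcons k0 bs subnK.
Qed.

Lemma uniq_compositions n d : uniq (compositions n d).
Proof.
elim: n d => [|n IHn] [|d] //; apply: allpairs_uniq_dep => [|k _|].
- exact: iota_uniq.
- exact: IHn.
by move=> [k a] [l b] _ _ /= /rcons_inj[-> ->].
Qed.

Lemma sum_compositions n d : (d <= n)%N ->
  \sum_(a <- compositions n d)
    ((-1) ^+ size a / (Z a)%:R : rat) *: (\prod_(k <- a) P k) = E d.
Proof.
elim: n d => [|n IHn] [|d] //.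
1,2: by rewrite big_seq1 big_nil /Z big_ord0 expr0 divr1 scale1r E0.
(* Scaling by [d.+1] brings in [newton_E]; it will cancel the last partial sum in [Z], while the
   sign of the removed part gives the minus sign. *)
move=> dn; apply: (@scalerI _ _ d.+1%:R); first by rewrite pnatr_eq0.
rewrite newton_E big_allpairs_dep -sumrN scaler_sumr.
apply: eq_big_seq => k; rewrite mem_index_iota ltnS => /andP[k0 kd].
have dkn : (d.+1 - k <= n)%N.
  by case: k k0 kd => // k _ _; rewrite subSS (leq_trans (leq_subr _ _)).
rewrite -(IHn _ dkn) mulr_sumr -sumrN scaler_sumr; apply: eq_big_seq => a.
move=> /(mem_compositions _ _ _ dkn)[_ sa].
rewrite series_mulZr -scaleNr scalerA size_rcons Z_rcons sa subnK //.
rewrite big_rcons /= mulrC.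
congr (_ *: _); last exact: mulrC.
by rewrite natrM invfM mulrA mulfVK ?pnatr_eq0 // exprS mulN1r mulNr.
Qed.

Theorem proposition20 (d : nat) :
  E d = \sum_(delta \in PCom_sqf d)
          ((-1) ^+ pcom_length delta / (Z_pcom delta)%:R : rat) *: P_pcom delta.
Proof.
have memP a : a \in compositions d d -> pcom_of_comp a \in PCom_sqf d.
  move=> /(mem_compositions _ _ _ (leqnn d)) da; apply/mem_set.
  split; last by exists a.
  have [a0 ad] := da; split=> [|i|].
  + by rewrite fsfun_withE fsfun0E.
  + by rewrite fsfun_withE; case: eqP => // _; rewrite fsfun0E.
  + rewrite (big_pcom_of_comp _ _ _ (fun i b => i * sumn b)%N) ?mul1n // => i.
    by rewrite muln0.
rewrite -(sum_compositions _ _ (leqnn d)).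
(* The fuel [d] makes the list complete, and evaluation at 1 recovers the composition, so each index
   occurs exactly once. *)
rewrite (fsbigE (map pcom_of_comp (compositions d d))).
- rewrite big_map big_seq [RHS]big_seq_cond.
  rewrite [RHS](eq_bigl (fun a => a \in compositions d d)) => [|a]; last first.
    by apply: andb_idr => /memP.
  apply: eq_bigr => a _.
  by rewrite P_pcom_of_comp pcom_length_of_comp /Z_pcom pcom_of_compE.
- rewrite map_inj_uniq ?uniq_compositions // => a b.
  by move=> /(congr1 (fun f : comp_seq => f 1%N)); rewrite !pcom_of_compE.
- by move=> _ /mapP[a /memP/set_mem da ->].
- move=> _ [_ [a da ->]]; case/negP.
  by apply: map_f; apply/mem_compositions.
Qed.
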